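(* Let $\mathbb{H}$ be a real Hilbert space and $C\subset\mathbb{H}$ a nonempty closed convex set. Let $f:C\times C\to\mathbb{R}$ satisfy $f(x,x)=0$ for all $x\in C$ and the following conditions: (i) $f$ is monotone on $C$: $f(x,y)+f(y,x)\le 0$ for all $x,y\in C$; (ii) for every $x\in C$, $f(x,\cdot)$ is convex, lower semicontinuous and subdifferentiable on $C$; (iii) for all $x,y,z\in C$, $\limsup_{t\downarrow 0} f(tz+(1-t)x,y)\le f(x,y)$. Let $T:C\to C$ be an $(\alpha,\beta,\gamma,\delta)$-symmetric generalized hybrid mapping with $\alpha+2\beta+\gamma\ge 0$, $\alpha+\beta>0$, $\delta\ge 0$, and $Fix(T)\neq\emptyset$. Suppose that $S=Sol(C,f)\cap Fix(T)$ is nonempty. Let $x^0\in C$, $\underline{\rho}>0$, $\{\rho_k\}\subset[\underline{\rho},+\infty)$, $\{\alpha_k\}\subset[0,1]$ with $\lim_{k\to\infty}\alpha_k=1$, $\underline{\beta}\in(0,1)$, and $\{\beta_k\}\subset[\underline{\beta},\bar{\beta}]\subset[0,1)$. Let the sequences $\{u^k\},\{v^k\},\{x^k\}$ be generated, for $k=0,1,2,\dots$, by: - $u^k\in C$ is such that $f(u^k,y)+\frac{1}{\rho_k}\langle y-u^k,u^k-x^k\rangle\ge 0$ for all $y\in C$; - $v^k=\alpha_kx^k+(1-\alpha_k)Tx^k$; - $x^{k+1}=\beta_kv^k+(1-\beta_k)Tu^k$. Then the sequences $\{x^k\}$ and $\{u^k\}$ converge weakly to a point $x^*\in S$, where $x^*=\lim_{k\to\infty}P_S(x^k)$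 (strong limit).
   Context: $Sol(C,f)=\{x^*\in C: f(x^*,y)\ge 0\ \ \forall y\in C\}$ is the solution set of the equilibrium problem, and $Fix(T)=\{x\in C: Tx=x\}$. A mapping $T:C\to\mathbb{H}$ is $(\alpha,\beta,\gamma,\delta)$-symmetric generalized hybrid, for $\alpha,\beta,\gamma,\delta\in\mathbb{R}$, if $$\alpha\|Tx-Ty\|^2+\beta\big(\|x-Ty\|^2+\|y-Tx\|^2\big)+\gamma\|x-y\|^2+\delta\big(\|x-Tx\|^2+\|y-Ty\|^2\big)\le 0\quad\forall x,y\in C.$$ Subdifferentiability of $f(x,\cdot)$ on $C$ means that for every $z\in C$ the set $\{w\in\mathbb{H}: f(x,y)\ge f(x,z)+\langle w,y-z\rangle\ \forall y\in C\}$ is nonempty. $P_S$ denotes the metric projection onto the nonempty closed convex set $S$. Under the stated hypotheses on $f$, the point $u^k$ exists and is unique. *)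

(* Defs.v *)
From HB Require Import structures.
From mathcomp Require Import all_boot all_order all_algebra.
From mathcomp Require Import sesquilinear.
From mathcomp Require Import all_classical all_reals all_analysis.

Set Implicit Arguments.
Unset Strict Implicit.
Unset Printing Implicit Defensive.

Import Order.TTheory GRing.Theory Num.Theory.
Import numFieldNormedType.Exports.

Local Open Scope classical_set_scope.
Local Open Scope ring_scope.

(* The scalar product is a symmetric positive definite bilinear form (theta is
   the identity) which induces the norm of the Banach space. *)
HB.mixin Record NormedModule_hasInner (R : realType) (H : Type)
    & NormedModule R H := {
  inner : {dot H for idfun : R -> R};
  inner_norm : forall x : H, inner x x = `|x| ^+ 2
}.

#[short(type="hilbertType")]
HB.structure Definition Hilbert (R : realType) :=
  {H of CompleteNormedModule R H & NormedModule_hasInner R H}.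

(* Maps defined on C are represented by total functions; their values outside
   C are never used, since every condition below is relative to C. *)
Section equilibrium.
Context {R : realType} {H : hilbertType R}.
Implicit Types (C S : set H) (f : H -> H -> R) (T : H -> H) (g : H -> R).

Definition Sol C f : set H :=
  [set x | C x /\ forall y, C y -> 0 <= f x y].

Definition Fix C T : set H := [set x | C x /\ T x = x].

Definition monotone_bifunction C f :=
  forall x y, C x -> C y -> f x y + f y x <= 0.

Definition subdifferentiable_on C g :=
  forall z, C z ->
    exists w : H, forall y, C y -> g z + inner w (y - z) <= g y.

(* The topology of [subspace C] is the one induced on C (the points outside C
   being isolated). *)
Definition lower_semicontinuous_on C g :=
  lower_semicontinuous (fun y : subspace C => (g y)%:E).

Definition upper_hemicontinuous C f :=
  forall x y z, C x -> C y -> C z ->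
    (limf_esup (fun t : R => (f (t *: z + (1 - t) *: x) y)%:E) 0^'+
       <= (f x y)%:E)%E.

Definition symmetric_generalized_hybrid C T (a b c d : R) :=
  forall x y, C x -> C y ->
    a * `|T x - T y| ^+ 2
    + b * (`|x - T y| ^+ 2 + `|y - T x| ^+ 2)
    + c * `|x - y| ^+ 2
    + d * (`|x - T x| ^+ 2 + `|y - T y| ^+ 2) <= 0.

Definition metric_proj S (x : H) : H :=
  get [set p | S p /\ forall q, S q -> `|x - p| <= `|x - q|].

(* Convergence in the weak topology, i.e., against every element of the
   topological dual. *)
Definition weakly_cvg (x : nat -> H) (l : H) :=
  forall phi : {linear H -> R^o}, continuous phi ->
    phi (x k) @[k --> \oo] --> phi l.

End equilibrium.

(* Main.v *)
(* Weak limits are taken along ultrafilters finer than the Frechet filter, so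
   that every bounded sequence has one, by compactness of segments and the Riesz
   representation.  For p in S the iteration satisfies
   kappa (|x_k - u_k|^2 + |v_k - T u_k|^2) <= |x_k - p|^2 - |x_(k+1) - p|^2
   with kappa = beta_low (1 - beta_up), hence x_k - u_k and u_k - T u_k vanish.
   A weak limit q of (x_k) is then one of (u_k); it is fixed by T because hybrid
   maps are demiclosed, and it solves the equilibrium problem because, by
   Minty's lemma, Sol is the set where every f(y, .), y in C, is nonpositive.
   The Fejer property makes P_S(x_k) a Cauchy sequence, and the variational
   inequality <x_k - P_S x_k, q - P_S x_k> <= 0 shows in the limit that q is the
   limit of P_S(x_k), whatever the ultrafilter. *)
From HB Require Import structures.
Require Import Defs.
From mathcomp Require Import all_boot all_order all_algebra.
From mathcomp Require Import sesquilinear ring lra.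
From mathcomp Require Import all_classical all_reals all_analysis.

Import Order.TTheory GRing.Theory Num.Theory.
Import numFieldNormedType.Exports.

Local Open Scope classical_set_scope.
Local Open Scope ring_scope.

Set Implicit Arguments.
Unset Strict Implicit.
Unset Printing Implicit Defensive.

(** * Inner product calculus and minimisation over closed convex sets *)

Section inner_product.
Context {R : realType} {H : hilbertType R}.
Implicit Types (x y z : H).

Lemma innerC x y : inner x y = inner y x.
Proof. by rewrite hermC expr0 mul1r. Qed.

Lemma innerDl x y z : inner (x + y) z = inner x z + inner y z.
Proof. exact: linearDl. Qed.

Lemma innerNl x z : inner (- x) z = - inner x z.
Proof. exact: linearNl. Qed.

Lemma innerZl (t : R) x z : inner (t *: x) z = t * inner x z.
Proof. exact: linearZl_LR. Qed.

Lemma innerDr x y z : inner z (x + y) = inner z x + inner z y.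
Proof. exact: linearDr. Qed.

Lemma innerNr x z : inner z (- x) = - inner z x.
Proof. exact: linearNr. Qed.

Lemma innerZr (t : R) x z : inner z (t *: x) = t * inner z x.
Proof. exact: linearZr_LR. Qed.

Definition innerE := (innerDl, innerDr, innerNl, innerNr, innerZl, innerZr).

Lemma normB_sq x y : `|x - y| ^+ 2 = `|x| ^+ 2 - 2 * inner x y + `|y| ^+ 2.
Proof. by rewrite -!inner_norm !innerE (innerC y x); ring. Qed.

Lemma normD_sq x y : `|x + y| ^+ 2 = `|x| ^+ 2 + 2 * inner x y + `|y| ^+ 2.
Proof. by rewrite -!inner_norm !innerE (innerC y x); ring. Qed.

(** The subtracted term measures strong convexity. It drives the Cauchy estimate for minimising
    sequences, the convexity of [Fix] and the Fejer estimate of one step. *)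
Lemma norm_conv_sq (t : R) x y :
  `|t *: x + (1 - t) *: y| ^+ 2 =
  t * `|x| ^+ 2 + (1 - t) * `|y| ^+ 2 - t * (1 - t) * `|x - y| ^+ 2.
Proof. by rewrite -!inner_norm !innerE (innerC y x); ring. Qed.

Lemma inner_le x y : inner x y <= `|x| * `|y|.
Proof.
have [->|x0] := eqVneq x 0; first by rewrite linear0l normr0 mul0r.
have [->|y0] := eqVneq y 0; first by rewrite linear0r normr0 mulr0.
have nx : 0 < `|x| by rewrite normr_gt0.
have ny : 0 < `|y| by rewrite normr_gt0.
(* Expanding this square gives 2 |x| |y| (|x| |y| - <x, y>) >= 0, and the positive factor |x| |y|
   cancels. *)
have := sqr_ge0 `| `|y| *: x - `|x| *: y|.
rewrite normB_sq !normrZ !normr_id !innerE => h.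
have : 0 <= (`|x| * `|y|) * (`|x| * `|y| - inner x y) by nra.
by rewrite pmulr_rge0 ?mulr_gt0// subr_ge0.
Qed.

Lemma abs_inner_le x y : `|inner x y| <= `|x| * `|y|.
Proof.
rewrite ler_norml inner_le andbT lerNl -(normrN x) -innerNl.
exact: inner_le.
Qed.

Lemma cvg_inner_l T (F : set_system T) {FF : Filter F} (z : T -> H) l y :
  z k @[k --> F] --> l -> inner (z k) y @[k --> F] --> inner l y.
Proof.
move=> zl; apply/cvgrPdist_le => e e0.
have y1 : 0 < `|y| + 1 by rewrite ltr_wpDl.
near=> k; rewrite -innerNl -innerDl (le_trans (abs_inner_le _ _))//.
have : `|l - z k| <= e / (`|y| + 1).
  by near: k; apply: cvgr_dist_le => //; rewrite divr_gt0.
rewrite ler_pdivlMr// => h; apply: le_trans h.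
by rewrite ler_wpM2l// lerDl.
Unshelve. all: by end_near.
Qed.

Lemma cvg_inner0 T (F : set_system T) {FF : Filter F} (y z : T -> H) (M : R) :
  (\forall k \near F, `|y k| <= M) -> `|z k| @[k --> F] --> (0 : R) ->
  inner (y k) (z k) @[k --> F] --> (0 : R).
Proof.
move=> yM z0; apply/cvgr0Pnorm_le => e e0.
have M1 : 0 < `|M| + 1 by rewrite ltr_wpDl.
have /cvgr0Pnorm_le/(_ _ (divr_gt0 e0 M1)) ze := z0.
near=> k; rewrite (le_trans (abs_inner_le _ _))//.
have : `| `|z k| | <= e / (`|M| + 1) by near: k.
have yk : `|y k| <= M by near: k.
rewrite normr_id ler_pdivlMr// mulrC; apply: le_trans.
by rewrite ler_wpM2r// (le_trans yk)// (le_trans (ler_norm M))// lerDl.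
Unshelve. all: by end_near.
Qed.

Lemma cvg_cauchy_sq (z : nat -> H) (e : nat -> R) :
  (forall n m, (n <= m)%N -> `|z n - z m| ^+ 2 <= e n) ->
  e n @[n --> \oo] --> (0 : R) -> exists l : H, z n @[n --> \oo] --> l.
Proof.
move=> ze e0; suff /cvg_ex[l zl] : cvg (z n @[n --> \oo]) by exists l.
apply: cauchy_cvg; apply: cauchy_exP => d d0.
have d2 : 0 < d ^+ 2 by rewrite exprn_gt0.
have /cvgr0Pnorm_lt/(_ _ d2)[N _ NP] := e0.
exists (z N); exists N => // m Nm; rewrite /= -ball_normE /=.
rewrite -(@ltr_pXn2r _ 2) ?nnegrE ?normr_ge0 ?(ltW d0)//.
apply: le_lt_trans (ze _ _ Nm) _; apply: le_lt_trans (ler_norm _) _.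
exact: (NP N (leqnn N)).
Qed.

(* With [phi = inner x] this is the metric projection of [x] on [K]; with [K]
   the whole space it is the Riesz representation of [phi]. *)
Lemma quadratic_min (K : set H) (phi : {linear H -> R^o}) (M : R) :
  closed K -> K !=set0 ->
  (forall p q (t : R), K p -> K q -> 0 <= t <= 1 ->
     K (t *: p + (1 - t) *: q)) ->
  (forall y, `|phi y| <= M * `|y|) ->
  exists p, K p /\ forall q, K q -> phi (q - p) <= inner p (q - p).
Proof.
move=> Kcl [y0 Ky0] Kconv phiM.
(* If [phi] is [inner w], then J y = |y - w|^2 - |w|^2, so minimising [J] over [K] projects [w] on
   [K]. *)
pose J y : R := `|y| ^+ 2 - 2 * phi y.
pose E := [set J y | y in K].
(* Completing the square: |y|^2 - 2 M |y| >= - M^2. *)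
have JM y : - M ^+ 2 <= J y.
  have := le_trans (ler_norm _) (phiM y).
  have := sqr_ge0 (M - `|y|); rewrite /J; nra.
have infE : has_inf E.
  split; first by exists (J y0), y0.
  by exists (- M ^+ 2) => _ [y _ <-].
have Jge y : K y -> inf E <= J y.
  by move=> Ky; apply: ge_inf; [exact: infE.2 | exists y].
have /choice[y yP] : forall n, exists y, K y /\ J y < inf E + n.+1%:R^-1.
  move=> n; have n0 : 0 < n.+1%:R^-1 :> R by [].
  by have [_ [y Ky <-] Jy] := inf_adherent n0 infE; exists y.
have Jconv t p q : J (t *: p + (1 - t) *: q) =
    t * J p + (1 - t) * J q - t * (1 - t) * `|p - q| ^+ 2.
  have -> : J (t *: p + (1 - t) *: q) = `|t *: p + (1 - t) *: q| ^+ 2 -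
      2 * (t * (phi p : R) + (1 - t) * (phi q : R)).
    by rewrite /J linearD !linearZ.
  by rewrite norm_conv_sq /J; move: (phi p : R) (phi q : R) => a b; ring.
have [p yp] : exists p : H, y n @[n --> \oo] --> p.
  (* The midpoint lies in [K], so |y n - y m|^2 <= 2 (J (y n) + J (y m)) - 4 inf E, which is at most
     2/(n+1) + 2/(m+1) <= 4/(n+1). *)
  apply: (@cvg_cauchy_sq _ (fun n => 4 * n.+1%:R^-1)).
    move=> n m nm; have half : 0 <= (2^-1 : R) <= 1 by lra.
    have := Jge _ (Kconv _ _ _ (yP n).1 (yP m).1 half); rewrite Jconv.
    have := (yP n).2; have := (yP m).2.
    have : m.+1%:R^-1 <= n.+1%:R^-1 :> R by rewrite lef_pV2 ?posrE ?ler_nat.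
    move: (J _) (J _) (inf E) (_ ^+ 2) (n.+1%:R^-1 : R) (m.+1%:R^-1 : R).
    move=> /= Jn Jm I D en em; lra.
  rewrite -[X in _ --> X](mulr0 4); apply: cvgM; first exact: cvg_cst.
  exact: cvg_harmonic.
have Kp : K p.
  by apply: (closed_cvg K Kcl _ _ yp); apply: nearW => n; exact: (yP n).1.
have phic : continuous phi.
  apply/linear_bounded_continuous/linear_boundedP.
  by exists M; split; [exact: num_real | move=> r Mr z;
    apply: le_trans (phiM z) _; rewrite ler_wpM2r// ltW].
have Jp : J p <= inf E.
  have h1 : J (y n) @[n --> \oo] --> J p.
    have phiy : (phi (y n) : R) @[n --> \oo] --> (phi p : R).
      exact: (@continuous_cvg _ _ _ _ _ y phi p (phic p) yp).
    rewrite /J; apply: cvgB; first by apply: cvgM; exact: cvg_norm.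
    by apply: cvgM => //; exact: cvg_cst.
  have h2 : inf E + n.+1%:R^-1 @[n --> \oo] --> inf E + 0.
    by apply: cvgD; [exact: cvg_cst | exact: cvg_harmonic].
  rewrite -[inf E]addr0; apply: (ler_cvg_to h1 h2).
  by apply: nearW => n; apply/ltW; exact: (yP n).2.
exists p; split=> // q Kq.
(* first-order condition: compare [J p] with [J (p + t (q - p))], [t -> 0] *)
have Jt (t : R) : 0 < t -> t <= 1 ->
    0 <= 2 * (inner p (q - p) - phi (q - p)) + t * `|q - p| ^+ 2.
  move=> t0 t1; have t01 : 0 <= t <= 1 by rewrite ltW.
  have := le_trans Jp (Jge _ (Kconv _ _ _ Kq Kp t01)); rewrite Jconv.
  have -> : (phi (q - p) : R) = (phi q : R) - (phi p : R) by exact: linearB.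
  rewrite innerDr innerNr inner_norm /J => h.
  rewrite -(pmulr_rge0 _ t0); move: h; rewrite normB_sq (innerC q p); lra.
rewrite leNgt; apply/negP => hlt.
set A := inner p (q - p) - phi (q - p) in Jt.
have A0 : A < 0 by rewrite subr_lt0.
have D0 : 0 < `|q - p| ^+ 2 + 1 by rewrite ltr_wpDl// sqr_ge0.
(* With this [t] the right-hand side of [Jt] is at most A - t < 0, a contradiction; the [+ 1] keeps
   the denominator positive. *)
pose t := Order.min 1 (- A / (`|q - p| ^+ 2 + 1)).
have t0 : 0 < t by rewrite lt_min ltr01 divr_gt0// oppr_gt0.
have t1 : t <= 1 by rewrite ge_min lexx.
have : t * (`|q - p| ^+ 2 + 1) <= - A.
  by rewrite -ler_pdivlMr// ge_min lexx orbT.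
have := Jt t t0 t1; nra.
Qed.

End inner_product.

(** * Riesz representation, metric projection and weak limits along ultrafilters *)

Section weak_limits.
Context {R : realType} {H : hilbertType R}.
Implicit Types (x y z : H) (K : set H).

Lemma convex_setP K : convex_set K <->
  forall p q (t : R), K p -> K q -> 0 <= t <= 1 -> K (t *: p + (1 - t) *: q).
Proof.
split=> Kconv p q t; last first.
  by rewrite !inE => Kp Kq; apply: Kconv => //; rewrite ge0 le1.
move=> Kp Kq /andP[t0 t1].
by have := Kconv p q (Itv01 t0 t1); rewrite !inE; exact.
Qed.

(** On the whole space the variational inequality of the minimiser [w] may be tested at [y + w] and
    at [- y + w], which turns it into an equality. *)
Lemma riesz (phi : {linear H -> R^o}) (M : R) :
  (forall y, `|phi y| <= M * `|y|) -> exists w, forall y, phi y = inner w y.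
Proof.
move=> phiM.
have [w [_ wP]] : exists p, setT p /\ forall q, setT q ->
    phi (q - p) <= inner p (q - p).
  by apply: (quadratic_min _ _ _ phiM) => //; exists 0.
have phi_le y : phi y <= inner w y.
  by have := wP (y + w) I; rewrite addrK.
exists w => y; apply/le_anti; rewrite phi_le /=.
by have := phi_le (- y); rewrite linearN innerNr lerN2.
Qed.

(** The variational solution [p] satisfies |x - p|^2 + |q - p|^2 <= |x - q|^2 on [K]. This makes it
    a nearest point, so that [get] has something to choose, and the only one, so that [get] chooses
    [p]. *)
Lemma metric_projP K x : closed K -> K !=set0 -> convex_set K ->
  K (metric_proj K x) /\
  forall q, K q -> inner (x - metric_proj K x) (q - metric_proj K x) <= 0.
Proof.
move=> Kcl K0 Kconv.
have lin : linear (inner x : H -> R^o).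
  by move=> t y z; rewrite innerDr innerZr.
pose phi : {linear H -> R^o} :=
  HB.pack (inner x : H -> R^o) (GRing.isLinear.Build R H R^o _ _ lin).
have [p [Kp pP]] := quadratic_min (phi := phi) Kcl K0
  ((convex_setP K).1 Kconv) (abs_inner_le x).
have {}pP q : K q -> inner (x - p) (q - p) <= 0.
  by move=> /pP /=; rewrite innerDl innerNl subr_le0.
have pythagoras q : K q -> `|x - p| ^+ 2 + `|q - p| ^+ 2 <= `|x - q| ^+ 2.
  move=> /pP; have -> : x - q = (x - p) - (q - p) by rewrite opprB addrA subrK.
  by rewrite [X in _ -> _ <= X]normB_sq; lra.
suff -> : metric_proj K x = p by [].
have [Km mP] : K (metric_proj K x) /\
    forall q, K q -> `|x - metric_proj K x| <= `|x - q|.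
  apply: (@getPex _ [set m | K m /\ forall q, K q -> `|x - m| <= `|x - q|]).
  exists p; split=> // q Kq; rewrite -ler_sqr ?nnegrE ?normr_ge0//.
  by apply: le_trans (pythagoras _ Kq); rewrite lerDl sqr_ge0.
apply/eqP; rewrite -subr_eq0 -normr_eq0 -sqrf_eq0 eq_le sqr_ge0 andbT.
have := pythagoras _ Km; have := mP _ Kp.
by rewrite -ler_sqr ?nnegrE ?normr_ge0// => h1 h2; lra.
Qed.

(** If the preimage of a neighbourhood is missing from [F], the trace of [F] on its complement is
    proper and extends to an ultrafilter finer than [F] along which [g] does not converge to [l]. *)
Lemma cvg_ultra {X : topologicalType} (F : set_system nat) (g : nat -> X)
    (l : X) :
  Filter F ->
  (forall G, UltraFilter G -> F `<=` G -> g k @[k --> G] --> l) ->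
  g k @[k --> F] --> l.
Proof.
move=> FF gU A Al; apply: contrapT => nFA.
have WP : ProperFilter (within (~` (g @^-1` A)) F).
  split; last exact: within_filter.
  rewrite /within /= => F0; apply: nFA.
  by apply: (@filterS _ F _ _ _ _ F0) => k /= h; apply: contrapT.
have [G [GU WG]] := ultraFilterLemma WP.
have FG : F `<=` G.
  by move=> B FB; apply: WG; apply: (@filterS _ F _ _ _ _ FB) => k Bk _.
have GA : G (g @^-1` A) := gU G GU FG A Al.
have GnA : G (~` (g @^-1` A)).
  by apply: WG; apply: (@filterS _ F _ _ _ _ (@filterT _ F FF)) => k _.
have GP := @ultra_proper _ G GU.
by have [k [kA]] := filter_ex (filterI GA GnA).
Qed.

(** By compactness the image of [F] clusters at a point of [[- M, M]], and an ultrafilter converges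
    to each of its cluster points. *)
Lemma ultra_cvg_bounded (F : set_system nat) (g : nat -> R) (M : R) :
  UltraFilter F -> (forall k, `|g k| <= M) ->
  exists l : R, g k @[k --> F] --> l.
Proof.
move=> FU gM; have FP := @ultra_proper _ F FU.
have gI : F (g @^-1` `[- M, M]).
  by apply: filterE => k; rewrite /= in_itv /= -ler_norml.
have [l [_ lcl]] := @segment_compact R (- M) M (g k @[k --> F]) _ gI.
exists l => A Al.
have [//|FnA] := in_ultra_setVsetC (g @^-1` A) FU.
have [r [rnA rA]] := lcl (~` A) A FnA Al.
by [].
Qed.

(** One ultrafilter serves all [y] at once, so no diagonal extraction occurs: the scalar limits form
    a linear functional bounded by [M], which Riesz represents by [q]. *)
Lemma ultra_weak_limit (F : set_system nat) (z : nat -> H) (M : R) :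
  UltraFilter F -> (forall k, `|z k| <= M) ->
  exists q, forall y, inner (z k) y @[k --> F] --> inner q y.
Proof.
move=> FU zM; have FP := @ultra_proper _ F FU.
have bnd y k : `|inner (z k) y| <= M * `|y|.
  by apply: le_trans (abs_inner_le _ _) _; rewrite ler_wpM2r.
have /choice[phi phiP] : forall y, exists l : R, inner (z k) y @[k --> F] --> l.
  by move=> y; apply: (ultra_cvg_bounded FU (bnd y)).
have lin : linear (phi : H -> R^o).
  move=> t y w.
  have h : inner (z k) (t *: y + w) @[k --> F] --> t * phi y + phi w.
    under eq_fun do rewrite innerDr innerZr.
    by apply: cvgD => //; apply: cvgM => //; exact: cvg_cst.
  exact: (cvg_unique _ (phiP _) h).
pose f : {linear H -> R^o} :=
  HB.pack (phi : H -> R^o) (GRing.isLinear.Build R H R^o _ _ lin).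
have fM y : `|f y| <= M * `|y|.
  have h : `|inner (z k) y| @[k --> F] --> `|phi y|.
    by apply: cvg_norm; exact: phiP.
  rewrite /f /=; apply: (cvgr_to_le h); apply: filterE => k; exact: bnd.
have [q qP] := riesz fM.
by exists q => y; rewrite -qP; exact: phiP.
Qed.

(** With [p] the projection of [q] on [K], the inequality <q - p, z k - p> <= 0 passes to the weak
    limit and gives |q - p|^2 <= 0. *)
Lemma weak_limit_closed K (F : set_system nat) (z : nat -> H) q :
  ProperFilter F -> closed K -> convex_set K -> (forall k, K (z k)) ->
  (forall y, inner (z k) y @[k --> F] --> inner q y) -> K q.
Proof.
move=> FP Kcl Kconv Kz zq.
have K0 : K !=set0 by exists (z 0).
have [Kp pP] := metric_projP q Kcl K0 Kconv.
set p := metric_proj K q in Kp pP.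
have h : inner (q - p) (z k - p) @[k --> F] -->
    inner q (q - p) - inner p (q - p).
  under eq_fun do rewrite innerC innerDl innerNl.
  by apply: cvgB => //; exact: cvg_cst.
have : inner (q - p) (q - p) <= 0.
  rewrite {1}innerDl innerNl.
  by apply: (cvgr_to_le h); apply: filterE => k; exact: pP.
rewrite inner_norm => qp.
suff -> : q = p by [].
by apply/eqP; rewrite -subr_eq0 -normr_eq0 -sqrf_eq0 eq_le qp sqr_ge0.
Qed.

End weak_limits.

(** * Fixed points of hybrid maps and solutions of the equilibrium problem *)

Section equilibrium_fixed_point.
Context {R : realType} {H : hilbertType R}.
Implicit Types (C : set H) (f : H -> H -> R) (T : H -> H) (p q : H).

Lemma convex_function_le C (g : H -> R) p q (t : R) : convex_function C g ->
  C p -> C q -> 0 <= t <= 1 ->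
  g (t *: p + (1 - t) *: q) <= t * g p + (1 - t) * g q.
Proof.
move=> gconv Cp Cq /andP[t0 t1].
by have := gconv (Itv01 t0 t1) p q; rewrite !inE; exact.
Qed.

Lemma closure_normP C p :
  closure C p <-> forall e : R, 0 < e -> exists2 q, C q & `|p - q| < e.
Proof.
split=> [clp e e0|clp B].
  have [q [Cq]] := clp _ (nbhsx_ballx p e e0).
  by rewrite -ball_normE /= => pq; exists q.
move=> /nbhs_ballP[e /= e0 eB]; have [q Cq pq] := clp e e0.
by exists q; split=> //; apply: eB; rewrite -ball_normE.
Qed.

(** The hybrid inequality at the pair (x, p) reads (a + b) |T x - p|^2 + (b + c) |x - p|^2 + d |x -
    T x|^2 <= 0, and b + c >= - (a + b). *)
Lemma hybrid_quasi_nonexpansive C T (a b c d : R) p x :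
  symmetric_generalized_hybrid C T a b c d ->
  0 <= a + 2 * b + c -> 0 < a + b -> 0 <= d ->
  Fix C T p -> C x -> `|T x - p| <= `|x - p|.
Proof.
move=> hyb abc ab d0 [Cp Tp] Cx; have := hyb _ _ Cx Cp.
rewrite Tp subrr normr0 (distrC p (T x)) => h.
rewrite -ler_sqr ?nnegrE ?normr_ge0//.
have := mulr_ge0 d0 (sqr_ge0 `|x - T x|).
have := mulr_ge0 abc (sqr_ge0 `|x - p|).
by rewrite -(ler_pM2l ab); lra.
Qed.

Lemma closed_Fix C T : closed C ->
  (forall p x, Fix C T p -> C x -> `|T x - p| <= `|x - p|) -> closed (Fix C T).
Proof.
move=> Ccl qne p /closure_normP clp.
have Cp : C p.
  by apply: Ccl; apply/closure_normP => e /clp[q [Cq _] pq]; exists q.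
split=> //; apply/eqP; rewrite -subr_eq0 -normr_le0.
apply/ler_addgt0Pr => e e0; rewrite add0r.
(* A fixed point [q] within e/2 of [p] suffices, since |T p - p| <= |T p - q| + |p - q| <= 2 |p -
   q|. *)
have e2 : 0 < e / 2 by rewrite divr_gt0.
have [q Fq pq] := clp _ e2.
have -> : T p - p = (T p - q) - (p - q) by rewrite opprB addrA subrK.
have := qne _ _ Fq Cp; have := ler_normB (T p - q) (p - q); lra.
Qed.

Lemma convex_Fix C T : convex_set C ->
  (forall p x, Fix C T p -> C x -> `|T x - p| <= `|x - p|) ->
  convex_set (Fix C T).
Proof.
move=> /convex_setP Cconv qne; apply/convex_setP => p q t Fp Fq t01.
have Cz := Cconv _ _ _ Fp.1 Fq.1 t01; split=> //.
set z := _ + _ in Cz *.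
(* The right-hand side depends on [y] only through its distances to [p] and [q]. These do not
   increase from [z] to [T z], so |T z - z|^2 is at most the value at [z], which is 0. *)
have sq y : `|y - z| ^+ 2 = t * `|y - p| ^+ 2 + (1 - t) * `|y - q| ^+ 2 -
    t * (1 - t) * `|p - q| ^+ 2.
  have -> : y - z = t *: (y - p) + (1 - t) *: (y - q).
    by rewrite /z !scalerBr addrACA -scalerDl (addrC t) subrK scale1r opprD.
  rewrite norm_conv_sq.
  have -> : y - p - (y - q) = q - p by rewrite opprB addrC addrA subrK.
  by rewrite (distrC q).
have hp := qne _ _ Fp Cz; have hq := qne _ _ Fq Cz.
have hp2 : `|T z - p| ^+ 2 <= `|z - p| ^+ 2 by rewrite ler_sqr ?nnegrE.
have hq2 : `|T z - q| ^+ 2 <= `|z - q| ^+ 2 by rewrite ler_sqr ?nnegrE.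
apply/eqP; rewrite -subr_eq0 -normr_eq0 -sqrf_eq0 eq_le sqr_ge0 andbT.
have := sq z; rewrite subrr normr0 expr0n /= => z0; rewrite sq.
move: t01 => /andP[t0 t1].
by have := ler_wpM2l t0 hp2; have := @ler_wpM2l _ (1 - t) _ _ _ hq2; lra.
Qed.

(** One direction is monotonicity. For the other, put z = t y + (1 - t) p: convexity gives 0 = f z z
    <= t f z y + (1 - t) f z p <= t f z y, and hemicontinuity lets t tend to 0. *)
Lemma Minty C f p : convex_set C -> (forall x, C x -> f x x = 0) ->
  monotone_bifunction C f -> (forall x, C x -> convex_function C (f x)) ->
  upper_hemicontinuous C f ->
  Sol C f p <-> C p /\ forall y, C y -> f y p <= 0.
Proof.
move=> Cconv fxx fmon fconv fhemi; split=> -[Cp pP]; split=> // y Cy.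
  by have := fmon _ _ Cp Cy; have := pP _ Cy; lra.
rewrite -lee_fin; apply: le_trans (fhemi _ _ _ Cp Cy Cy).
(* The upper limit is an infimum over neighbourhoods [V] of suprema over [V], so one [t] in [V] with
   0 < t < 1 and a nonnegative value is enough. *)
apply: le_ereal_inf_tmp => _ [V /= V0 <-].
have [t [Vt /andP[t0 t1]]] : exists t : R, V t /\ 0 < t < 1.
  apply: (@filter_ex _ (0 : R)^'+); apply: filterI => //.
  near=> t; apply/andP; split; near: t.
    exact: nbhs_right_gt.
  exact: nbhs_right_lt.
apply: le_ereal_sup_tmp; exists (f (t *: y + (1 - t) *: p) y)%:E.
  by exists t.
rewrite lee_fin; have t01 : 0 <= t <= 1 by rewrite !ltW.
have Cz := (convex_setP C).1 Cconv _ _ _ Cy Cp t01.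
have := convex_function_le (fconv _ Cz) Cy Cp t01.
rewrite (fxx _ Cz) => h; have fp := pP _ Cz.
by rewrite -(pmulr_rge0 _ t0); nra.
Unshelve. all: by end_near.
Qed.

(** This form is suited to weak limits: the error [inner w (p - y)] vanishes as [y] tends weakly to
    [p]. *)
Lemma subgradient_le_lim C (g : H -> R) p : subdifferentiable_on C g -> C p ->
  exists w, forall y, C y -> g p <= g y + inner w (p - y).
Proof.
move=> gsub Cp; have [w wP] := gsub _ Cp; exists w => y /wP.
by rewrite -opprB innerNr; lra.
Qed.

Lemma closed_Sol C f : closed C -> convex_set C ->
  (forall x, C x -> f x x = 0) ->
  monotone_bifunction C f -> (forall x, C x -> convex_function C (f x)) ->
  (forall x, C x -> subdifferentiable_on C (f x)) ->
  upper_hemicontinuous C f -> closed (Sol C f).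
Proof.
move=> Ccl Cconv fxx fmon fconv fsub fhemi p /closure_normP clp.
apply/Minty => //; have Cp : C p.
  by apply: Ccl; apply/closure_normP => e /clp[q [Cq _] pq]; exists q.
split=> // y Cy; have [w wP] := subgradient_le_lim (fsub _ Cy) Cp.
apply/ler_addgt0Pr => e e0; rewrite add0r.
have w1 : 0 < `|w| + 1 by rewrite ltr_wpDl.
(* The radius e / (|w| + 1) makes the error <w, p - q> at most [e]. *)
have [q Sq pq] := clp _ (divr_gt0 e0 w1).
have [Cq /(_ _ Cy) qP] : C q /\ forall y, C y -> f y q <= 0 by apply/Minty.
apply: le_trans (wP _ Cq) _.
have := inner_le w (p - q); move: pq; rewrite ltr_pdivlMr// => pq.
by have := normr_ge0 (p - q); nra.
Qed.

(** By [Minty], [Sol] is an intersection of sublevel sets of convex functions. *)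
Lemma convex_Sol C f : convex_set C -> (forall x, C x -> f x x = 0) ->
  monotone_bifunction C f -> (forall x, C x -> convex_function C (f x)) ->
  upper_hemicontinuous C f -> convex_set (Sol C f).
Proof.
move=> Cconv fxx fmon fconv fhemi; apply/convex_setP => p q t Sp Sq t01.
apply/Minty => //.
have [Cp pP] : C p /\ forall y, C y -> f y p <= 0 by apply/Minty.
have [Cq qP] : C q /\ forall y, C y -> f y q <= 0 by apply/Minty.
split=> [|y Cy]; first exact: (convex_setP C).1 Cconv _ _ _ Cp Cq t01.
apply: le_trans (convex_function_le (fconv _ Cy) Cp Cq t01) _.
by have := pP _ Cy; have := qP _ Cy; move: t01 => /andP[]; nra.
Qed.

Lemma cvg_norm0_sq (F : set_system nat) {FF : Filter F} (z : nat -> H)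
    (g : nat -> R) :
  (forall k, `|z k| ^+ 2 <= g k) -> g k @[k --> F] --> (0 : R) ->
  `|z k| @[k --> F] --> (0 : R).
Proof.
move=> zg g0; apply/cvgr0Pnorm_lt => e e0.
have e2 : 0 < e ^+ 2 by rewrite exprn_gt0.
have /cvgr0Pnorm_lt/(_ _ e2) ge := g0.
apply: filterS ge => k gk; rewrite normr_id.
rewrite -(@ltr_pXn2r _ 2) ?nnegrE ?normr_ge0 ?(ltW e0)//.
by apply: le_lt_trans (zg _) _; apply: le_lt_trans gk; exact: ler_norm.
Qed.

Lemma hybrid_demiclosed C T (a b c d : R) (F : set_system nat) (u : nat -> H)
    q (M : R) :
  ProperFilter F -> symmetric_generalized_hybrid C T a b c d ->
  0 <= a + 2 * b + c -> 0 < a + b -> 0 <= d ->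
  (forall k, C (u k)) -> C q -> (forall k, `|u k| <= M) ->
  (forall y, inner (u k) y @[k --> F] --> inner q y) ->
  `|u k - T (u k)| @[k --> F] --> (0 : R) -> T q = q.
Proof.
move=> FP hyb abc ab d0 Cu Cq uM uq r0.
pose r k := u k - T (u k); pose D := q - T q; pose w k := u k - q.
(* Expand the hybrid inequality at (u k, q) in terms of [w], [r] and [D], and drop the nonnegative
   (a + 2b + c) |w|^2, (a + b + d) |r|^2 and d |D|^2. Only inner products that tend to 0 remain on
   the right. *)
have key k : (a + b) * `|D| ^+ 2 <= - (2 * (a + b)) * inner (w k) D +
    2 * (a + b) * inner (w k) (r k) + 2 * a * inner D (r k).
  have := hyb _ _ (Cu k) Cq.
  have -> : T (u k) - T q = w k + (D - r k).
    rewrite /w /D /r opprB !addrA subrK addrAC (addrAC (u k)) subrr add0r.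
    exact: addrC.
  have -> : u k - T q = w k + D by rewrite /w /D addrA subrK.
  have -> : q - T (u k) = - (w k - r k).
    by rewrite /w /r !opprB [RHS]addrC addrA subrK.
  rewrite normrN -/(r k) -/(w k) -/D; move: (w k) (r k) (D) => W V E.
  rewrite normD_sq innerDr innerNr !normB_sq normD_sq.
  have := mulr_ge0 abc (sqr_ge0 `|W|).
  have := mulr_ge0 (ltW ab) (sqr_ge0 `|V|).
  have := mulr_ge0 d0 (sqr_ge0 `|V|).
  have := mulr_ge0 d0 (sqr_ge0 `|E|).
  lra.
have wD : inner (w k) D @[k --> F] --> (0 : R).
  rewrite -[X in _ --> X](subrr (inner q D)).
  under eq_fun do rewrite /w innerDl innerNl.
  by apply: cvgB => //; exact: cvg_cst.
have wr : inner (w k) (r k) @[k --> F] --> (0 : R).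
  apply: (@cvg_inner0 _ _ _ _ _ _ _ (M + `|q|)) => //.
  by apply: filterE => k; rewrite (le_trans (ler_normB _ _))// lerD2r.
have Dr : inner D (r k) @[k --> F] --> (0 : R).
  apply: (@cvg_inner0 _ _ _ _ _ (cst D) _ `|D|) => //.
  exact: filterE.
have lim0 : - (2 * (a + b)) * inner (w k) D +
    2 * (a + b) * inner (w k) (r k) + 2 * a * inner D (r k) @[k --> F] -->
    - (2 * (a + b)) * 0 + 2 * (a + b) * 0 + 2 * a * 0.
  by repeat apply: cvgD; apply: cvgM => //; exact: cvg_cst.
have : (a + b) * `|D| ^+ 2 <=
    - (2 * (a + b)) * 0 + 2 * (a + b) * 0 + 2 * a * 0.
  by apply: (cvgr_to_ge lim0); apply: filterE.
rewrite !mulr0 !addr0 pmulr_rle0// => D0.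
apply/esym/eqP; rewrite -subr_eq0 -normr_eq0 -sqrf_eq0 eq_le D0.
exact: sqr_ge0.
Qed.

End equilibrium_fixed_point.

(** * Fejer estimates for one step and passage to the limit *)

Section iteration.
Context {R : realType} {H : hilbertType R}.
Implicit Types (C S : set H) (f : H -> H -> R) (T : H -> H) (p q x u v : H).

(** Testing at [p], where f u p <= - f p u <= 0, gives <p - u, u - x> >= 0, the cross term in the
    expansion of |(u - p) - (u - x)|^2. *)
Lemma resolvent_fejer C f (rho : R) x u p : monotone_bifunction C f ->
  0 < rho -> C u ->
  (forall y, C y -> 0 <= f u y + rho^-1 * inner (y - u) (u - x)) ->
  Sol C f p -> `|u - p| ^+ 2 + `|x - u| ^+ 2 <= `|x - p| ^+ 2.
Proof.
move=> fmon rho0 Cu uP [Cp pP].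
have h : 0 <= rho^-1 * inner (p - u) (u - x).
  by have := uP _ Cp; have := fmon _ _ Cu Cp; have := pP _ Cu; lra.
have {h} : 0 <= inner (p - u) (u - x).
  by rewrite -(pmulr_rge0 _ (_ : 0 < rho^-1)) ?invr_gt0.
have -> : x - p = (u - p) - (u - x) by rewrite opprB [RHS]addrC addrA subrK.
rewrite [X in _ -> _ <= X]normB_sq (distrC x u) -(opprB u p) innerNl.
lra.
Qed.

(** [norm_conv_sq] is applied twice: its defect is dropped for [v], giving |v - p| <= |x - p|, and
    kept for [x']. *)
Lemma step_fejer T x u v x' p (al be : R) :
  `|T x - p| <= `|x - p| -> `|T u - p| <= `|u - p| -> 0 <= al <= 1 ->
  0 <= be <= 1 ->
  v = al *: x + (1 - al) *: T x -> x' = be *: v + (1 - be) *: T u ->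
  `|x' - p| ^+ 2 + be * (1 - be) * `|v - T u| ^+ 2 <=
  be * `|x - p| ^+ 2 + (1 - be) * `|u - p| ^+ 2.
Proof.
move=> Tx Tu /andP[al0 al1] /andP[be0 be1] vE xE.
have shift (t : R) y z :
    t *: y + (1 - t) *: z - p = t *: (y - p) + (1 - t) *: (z - p).
  by rewrite !scalerBr addrACA -opprD -scalerDl (addrC t) subrK scale1r.
have Tx2 : `|T x - p| ^+ 2 <= `|x - p| ^+ 2 by rewrite ler_sqr ?nnegrE.
have Tu2 : `|T u - p| ^+ 2 <= `|u - p| ^+ 2 by rewrite ler_sqr ?nnegrE.
have vp : `|v - p| ^+ 2 <= `|x - p| ^+ 2.
  rewrite vE shift norm_conv_sq.
  have := @ler_wpM2l _ (1 - al) _ _ _ Tx2; rewrite subr_ge0 => /(_ al1).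
  have : 0 <= al * (1 - al) * `|x - p - (T x - p)| ^+ 2.
    by rewrite !mulr_ge0 ?subr_ge0 ?sqr_ge0.
  lra.
rewrite xE shift norm_conv_sq opprB addrA subrK.
have := ler_wpM2l be0 vp.
by have := @ler_wpM2l _ (1 - be) _ _ _ Tu2; rewrite subr_ge0 => /(_ be1); lra.
Qed.

Lemma cvg_metric_proj S (x : nat -> H) : closed S -> S !=set0 ->
  convex_set S ->
  (forall p k, S p -> `|x k.+1 - p| ^+ 2 <= `|x k - p| ^+ 2) ->
  exists xs : H, S xs /\ metric_proj S (x k) @[k --> \oo] --> xs.
Proof.
move=> Scl S0 Sconv fejer; pose p k := metric_proj S (x k).
have pP k : S (p k) /\ forall q, S q -> inner (x k - p k) (q - p k) <= 0.
  exact: metric_projP.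
pose d k := `|x k - p k| ^+ 2.
have fejer_le q n m : S q -> (n <= m)%N -> `|x m - q| ^+ 2 <= `|x n - q| ^+ 2.
  move=> Sq; elim: m => [|m IH]; first by rewrite leqn0 => /eqP ->.
  rewrite leq_eqVlt => /predU1P[-> //|nm].
  exact: le_trans (fejer _ _ Sq) (IH nm).
(* The projection inequality at [x m] gives d m + |p n - p m|^2 <= |x m - p n|^2, and the Fejer
   property at [p n] bounds the latter by d n. *)
have dist n m : (n <= m)%N -> `|p n - p m| ^+ 2 <= d n - d m.
  move=> nm; have [Sn _] := pP n; have [_ /(_ _ Sn) h] := pP m.
  have := fejer_le _ _ _ Sn nm; rewrite /d.
  have -> : x m - p n = (x m - p m) - (p n - p m) by rewrite opprB addrA subrK.
  by rewrite normB_sq; lra.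
have d_cvg : cvgn d.
  apply: nonincreasing_is_cvgn.
    by move=> n m /dist; have := sqr_ge0 `|p n - p m|; lra.
  by exists 0 => _ [n _ <-]; exact: sqr_ge0.
have d_ge n : limn d <= d n.
  apply: limr_le => //; exists n => // m /= /dist.
  by have := sqr_ge0 `|p n - p m|; lra.
have [xs xsP] : exists xs : H, p k @[k --> \oo] --> xs.
  apply: (@cvg_cauchy_sq _ _ _ (fun n => d n - limn d)).
    by move=> n m /dist; have := d_ge m; lra.
  by rewrite -[X in _ --> X](subrr (limn d)); apply: cvgB => //; exact: cvg_cst.
exists xs; split => //; apply: (closed_cvg S Scl _ _ xsP).
by apply: nearW => k; exact: (pP k).1.
Qed.

Lemma fejer_weak_limit S (F : set_system nat) (x : nat -> H) q xs (M : R) :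
  ProperFilter F -> closed S -> convex_set S -> S q ->
  (forall k, `|x k - metric_proj S (x k)| <= M) ->
  (forall y, inner (x k) y @[k --> F] --> inner q y) ->
  metric_proj S (x k) @[k --> F] --> xs -> q = xs.
Proof.
move=> FP Scl Sconv Sq xM xq pxs; pose p k := metric_proj S (x k).
have S0 : S !=set0 by exists q.
have le0 k : inner (x k - p k) (q - xs) + inner (x k - p k) (xs - p k) <= 0.
  (* Splitting q - p k at [xs] separates a weakly convergent part, with limit |q - xs|^2, from a
     bounded sequence paired with a vanishing one. *)
  rewrite -innerDr addrA subrK.
  by have [_] := metric_projP (x k) Scl S0 Sconv; exact.
have h1 : inner (x k - p k) (q - xs) @[k --> F] -->
    inner q (q - xs) - inner xs (q - xs).
  under eq_fun do rewrite innerDl innerNl.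
  by apply: cvgB; [exact: xq | exact: cvg_inner_l].
have h2 : inner (x k - p k) (xs - p k) @[k --> F] --> (0 : R).
  apply: (@cvg_inner0 _ _ _ _ _ _ _ M); first by apply: filterE => k; exact: xM.
  apply/norm_cvg0P; rewrite -(subrr xs).
  by apply: cvgB; [exact: cvg_cst|].
have : inner q (q - xs) - inner xs (q - xs) + 0 <= 0.
  by apply: (cvgr_to_le (cvgD h1 h2)); apply: filterE.
rewrite addr0 -innerNl -innerDl inner_norm => qxs.
by apply/eqP; rewrite -subr_eq0 -normr_eq0 -sqrf_eq0 eq_le qxs sqr_ge0.
Qed.

(** By [Minty] it suffices that f y q <= 0. A subgradient of [f y] at [q] bounds it by e y k + <w, q
    - u k>, which tends to 0; the rate [e] may depend on [y]. *)
Lemma Sol_weak_limit C f (F : set_system nat) (u : nat -> H) q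
    (e : H -> nat -> R) :
  ProperFilter F -> convex_set C -> (forall x, C x -> f x x = 0) ->
  monotone_bifunction C f -> (forall x, C x -> convex_function C (f x)) ->
  (forall x, C x -> subdifferentiable_on C (f x)) -> upper_hemicontinuous C f ->
  (forall k, C (u k)) -> C q ->
  (forall y, inner (u k) y @[k --> F] --> inner q y) ->
  (forall y k, C y -> f y (u k) <= e y k) ->
  (forall y, C y -> e y k @[k --> F] --> (0 : R)) -> Sol C f q.
Proof.
move=> FP Cconv fxx fmon fconv fsub fhemi Cu Cq uq fe e0.
apply/Minty => //; split=> // y Cy.
have [w wP] := subgradient_le_lim (fsub _ Cy) Cq.
have lim : e y k + inner w (q - u k) @[k --> F] -->
    0 + (inner q w - inner q w).
  apply: cvgD; first exact: e0.
  under eq_fun do rewrite innerC innerDl innerNl.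
  by apply: cvgB => //; exact: cvg_cst.
have : f y q <= 0 + (inner q w - inner q w); last by rewrite subrr addr0.
apply: (cvgr_to_ge lim); apply: filterE => k.
by apply: le_trans (wP _ (Cu k)) _; rewrite lerD2r fe.
Qed.

End iteration.

Unset Implicit Arguments.

(** * Weak convergence of the iterates to the limit of their projections *)

Theorem theorem3p1 (R : realType) (H : hilbertType R)
  (C : set H) (f : H -> H -> R) (T : H -> H) (a b c d : R)
  (C_nonempty : C !=set0) (C_closed : closed C) (C_convex : convex_set C)
  (f_diag : forall x, C x -> f x x = 0)
  (f_monotone : monotone_bifunction C f)
  (f_convex : forall x, C x -> convex_function C (f x))
  (f_lsc : forall x, C x -> lower_semicontinuous_on C (f x))
  (f_subdiff : forall x, C x -> subdifferentiable_on C (f x))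
  (f_hemi : upper_hemicontinuous C f)
  (T_C : forall x, C x -> C (T x))
  (T_hybrid : symmetric_generalized_hybrid C T a b c d)
  (abc_ge0 : 0 <= a + 2 * b + c) (ab_gt0 : 0 < a + b) (d_ge0 : 0 <= d)
  (Fix_nonempty : Fix C T !=set0)
  (S_nonempty : Sol C f `&` Fix C T !=set0)
  (rho alpha beta : nat -> R) (rho_low beta_low beta_up : R)
  (rho_low_gt0 : 0 < rho_low) (rho_ge : forall k, rho_low <= rho k)
  (alpha01 : forall k, 0 <= alpha k <= 1)
  (alpha_cvg : alpha k @[k --> \oo] --> (1 : R))
  (beta_low01 : 0 < beta_low < 1) (beta_up_lt1 : beta_up < 1)
  (beta_in : forall k, beta_low <= beta k <= beta_up)
  (x u v : nat -> H)
  (x0_C : C (x 0%N))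
  (u_C : forall k, C (u k))
  (uP : forall k y, C y ->
    0 <= f (u k) y + (rho k)^-1 * inner (y - u k) (u k - x k))
  (vE : forall k, v k = alpha k *: x k + (1 - alpha k) *: T (x k))
  (xE : forall k, x k.+1 = beta k *: v k + (1 - beta k) *: T (u k)) :
  exists xs : H,
    [/\ (Sol C f `&` Fix C T) xs,
        metric_proj (Sol C f `&` Fix C T) (x k) @[k --> \oo] --> xs,
        weakly_cvg x xs & weakly_cvg u xs].
Proof.
pose S := Sol C f `&` Fix C T.
have qne p y : Fix C T p -> C y -> `|T y - p| <= `|y - p|.
  exact: (hybrid_quasi_nonexpansive T_hybrid).
have S_closed : closed S.
  apply: closedI; last exact: closed_Fix.
  exact: closed_Sol.
have S_convex : convex_set S.
  have /convex_setP Sol_convex : convex_set (Sol C f) by exact: convex_Sol.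
  have /convex_setP Fix_convex : convex_set (Fix C T) by exact: convex_Fix.
  apply/convex_setP => p q t [p1 p2] [q1 q2] t01.
  by split; [exact: Sol_convex | exact: Fix_convex].
have Cc := (convex_setP C).1 C_convex.
have beta01 k : 0 <= beta k <= 1.
  by have := beta_in k; move: beta_low01 => /andP[] ? ? /andP[] ? ?; lra.
have x_C k : C (x k).
  elim: k => // k IH; rewrite xE vE.
  by apply: (Cc) => //; [apply: (Cc) => //; exact: T_C | exact: T_C].
have rho_gt0 k : 0 < rho k by exact: lt_le_trans (rho_ge k).
have u_fejer p k : S p ->
    `|u k - p| ^+ 2 + `|x k - u k| ^+ 2 <= `|x k - p| ^+ 2.
  by move=> [Sp _]; apply: (resolvent_fejer f_monotone (rho_gt0 k)) => // y;
    exact: uP.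
pose kappa := beta_low * (1 - beta_up).
have kappa_gt0 : 0 < kappa.
  by move: beta_low01 => /andP[? ?]; rewrite mulr_gt0 ?subr_gt0.
(* Add 1 - beta k times [u_fejer] to [step_fejer]; [kappa] is a common lower bound of the two
   coefficients 1 - beta k and beta k (1 - beta k). *)
have x_fejer p k : S p -> kappa * (`|x k - u k| ^+ 2 + `|v k - T (u k)| ^+ 2) <=
    `|x k - p| ^+ 2 - `|x k.+1 - p| ^+ 2.
  move=> Sp; have := u_fejer _ k Sp.
  have := step_fejer (qne _ _ Sp.2 (x_C k)) (qne _ _ Sp.2 (u_C k))
    (alpha01 k) (beta01 k) (vE k) (xE k).
  have [b0 b1] : 0 <= beta k /\ 0 <= 1 - beta k.
    by have /andP[? ?] := beta01 k; rewrite subr_ge0.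
  have [k1 k2] : kappa <= 1 - beta k /\ kappa <= beta k * (1 - beta k).
    have /andP[h1 h2] := beta_in k; move: beta_low01 => /andP[h3 h4].
    by rewrite /kappa; split; nra.
  have := ler_wpM2r (sqr_ge0 `|x k - u k|) k1.
  have := ler_wpM2r (sqr_ge0 `|v k - T (u k)|) k2.
  move=> h1 h2 h3 /(ler_wpM2l b1); lra.
have [p Sp] := S_nonempty.
have x_fejer0 q k : S q -> `|x k.+1 - q| ^+ 2 <= `|x k - q| ^+ 2.
  move=> Sq; rewrite -subr_ge0; apply: le_trans (x_fejer _ k Sq).
  by rewrite mulr_ge0 ?addr_ge0 ?sqr_ge0// ltW.
pose r := `|x 0%N - p|.
have x_bnd k : `|x k - p| <= r.
  elim: k => // k; apply: le_trans.
  by rewrite -ler_sqr ?nnegrE//; exact: x_fejer0.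
have u_bnd k : `|u k - p| <= r.
  apply: le_trans (x_bnd k); rewrite -ler_sqr ?nnegrE//.
  by apply: le_trans (u_fejer _ k Sp); rewrite lerDl sqr_ge0.
have norm_bnd y : `|y - p| <= r -> `|y| <= r + `|p|.
  by move=> yp; rewrite -[y](subrK p) (le_trans (ler_normD _ _))// lerD2r.
(* Differences of consecutive terms of a convergent sequence vanish, and [gap] dominates both
   residuals. *)
pose gap k := kappa^-1 * (`|x k - p| ^+ 2 - `|x k.+1 - p| ^+ 2).
have gap0 : gap k @[k --> \oo] --> (0 : R).
  have dc : cvgn (fun k => `|x k - p| ^+ 2).
    apply: nonincreasing_is_cvgn.
      by apply/nonincreasing_seqP => k; exact: x_fejer0.
    by exists 0 => _ [k _ <-]; exact: sqr_ge0.
  rewrite -[X in _ --> X](mulr0 kappa^-1); apply: cvgM; first exact: cvg_cst.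
  rewrite -[X in _ --> X](subrr (limn (fun k => `|x k - p| ^+ 2))).
  by apply: cvgB; [exact: dc | rewrite (cvg_shiftS (fun k => `|x k - p| ^+ 2))].
have gap_ge k : `|x k - u k| ^+ 2 <= gap k /\ `|v k - T (u k)| ^+ 2 <= gap k.
  have : `|x k - u k| ^+ 2 + `|v k - T (u k)| ^+ 2 <= gap k.
    by rewrite /gap ler_pdivlMl//; exact: x_fejer.
  have := sqr_ge0 `|x k - u k|; have := sqr_ge0 `|v k - T (u k)|.
  by move=> *; split; lra.
have xu0 : `|x k - u k| @[k --> \oo] --> (0 : R).
  by apply: cvg_norm0_sq gap0 => k; exact: (gap_ge k).1.
have vTu0 : `|v k - T (u k)| @[k --> \oo] --> (0 : R).
  by apply: cvg_norm0_sq gap0 => k; exact: (gap_ge k).2.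
(* The factor 2 r bounds |x k - T (x k)|, both points being within [r] of [p]; the product vanishes
   as [alpha] tends to 1. *)
have xv_le k : `|x k - v k| <= (1 - alpha k) * (2 * r).
  have /andP[a0 a1] := alpha01 k.
  have -> : x k - v k = (1 - alpha k) *: (x k - T (x k)).
    by rewrite vE opprD addrA scalerBr; congr (_ - _); rewrite scalerBl scale1r.
  rewrite normrZ ger0_norm ?subr_ge0// ler_wpM2l ?subr_ge0//.
  have -> : x k - T (x k) = (x k - p) - (T (x k) - p).
    by rewrite opprB addrA subrK.
  have := ler_normB (x k - p) (T (x k) - p).
  by have := qne _ _ Sp.2 (x_C k); have := x_bnd k; lra.
have uTu0 : `|u k - T (u k)| @[k --> \oo] --> (0 : R).
  have lim : `|x k - u k| + (1 - alpha k) * (2 * r) + `|v k - T (u k)|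
      @[k --> \oo] --> (0 + (1 - 1) * (2 * r) + 0 : R).
    apply: cvgD => //; apply: cvgD => //; apply: cvgM; last exact: cvg_cst.
    by apply: cvgB => //; exact: cvg_cst.
  rewrite subrr mul0r !addr0 in lim.
  apply: (squeeze_cvgr _ (cvg_cst 0) lim); apply: nearW => k.
  rewrite normr_ge0 /=; have := xv_le k.
  have -> : u k - T (u k) = (x k - v k) - (x k - u k) + (v k - T (u k)).
    have -> : x k - v k - (x k - u k) = u k - v k.
      by rewrite opprB addrC addrA subrK.
    by rewrite addrA subrK.
  have := ler_normD (x k - v k - (x k - u k)) (v k - T (u k)).
  by have := ler_normB (x k - v k) (x k - u k); lra.
have [xs [Sxs pxs]] := cvg_metric_proj S_closed S_nonempty S_convex x_fejer0.
(* Monotonicity and the inequality defining [u k] give f y (u k) <= <y - u k, u k - x k> / rho k;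
   then use Cauchy-Schwarz, the bound on [u k] and rho k >= rho_low. *)
pose e (y : H) k := rho_low^-1 * ((`|y| + (r + `|p|)) * `|x k - u k|).
have e0 y : e y k @[k --> \oo] --> (0 : R).
  rewrite -[X in _ --> X](mulr0 rho_low^-1); apply: cvgM; first exact: cvg_cst.
  rewrite -[X in _ --> X](mulr0 (`|y| + (r + `|p|))).
  by apply: cvgM => //; exact: cvg_cst.
have fe y k : C y -> f y (u k) <= e y k.
  move=> Cy; have := f_monotone _ _ (u_C k) Cy; have := uP k _ Cy.
  have hi := inner_le (y - u k) (u k - x k); rewrite (distrC (u k)) in hi.
  have hn : `|y - u k| <= `|y| + (r + `|p|).
    by rewrite (le_trans (ler_normB _ _))// lerD2l norm_bnd.
  have hj := le_trans hi (ler_wpM2r (normr_ge0 (x k - u k)) hn).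
  have ri : (rho k)^-1 <= rho_low^-1 by rewrite lef_pV2 ?posrE.
  have ri0 : 0 <= (rho k)^-1 by rewrite invr_ge0 ltW.
  have := ler_wpM2l ri0 hj.
  have B0 : 0 <= (`|y| + (r + `|p|)) * `|x k - u k|.
    by rewrite mulr_ge0// (le_trans (normr_ge0 _) hn).
  by have := ler_wpM2r B0 ri; rewrite /e; lra.
have xmp_bnd k : `|x k - metric_proj S (x k)| <= r.
  have [Sm mP] := metric_projP (x k) S_closed S_nonempty S_convex.
  apply: le_trans (x_bnd k); rewrite -ler_sqr ?nnegrE//.
  have := mP _ Sp; set m := metric_proj S (x k).
  have -> : x k - p = (x k - m) - (p - m) by rewrite opprB addrA subrK.
  by rewrite [X in _ -> _ <= X]normB_sq; have := sqr_ge0 `|p - m|; lra.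
have weak (F : set_system nat) y : UltraFilter F -> \oo `<=` F ->
    inner (x k) y @[k --> F] --> inner xs y.
  move=> FU ooF; have FP := @ultra_proper _ F FU.
  have along (X : topologicalType) (g : nat -> X) (l : X) :
      g k @[k --> \oo] --> l -> g k @[k --> F] --> l.
    by move=> gl A /gl; exact: ooF.
  have [q xq] := ultra_weak_limit FU (fun k => norm_bnd _ (x_bnd k)).
  have uq z : inner (u k) z @[k --> F] --> inner q z.
    have h : inner (x k) z - inner z (x k - u k) @[k --> F] --> inner q z - 0.
      apply: cvgB => //; apply: (@cvg_inner0 _ _ _ _ _ (cst z) _ `|z|).
        exact: filterE.
      exact: along.
    rewrite subr0 in h; apply: cvg_trans h; apply: near_eq_cvg.
    apply: filterE => k.
    by rewrite (innerC z) innerDl innerNl opprB addrC subrK.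
  have Cq : C q by exact: (weak_limit_closed FP C_closed C_convex x_C xq).
  suff <- : q = xs by exact: xq.
  apply: (fejer_weak_limit FP S_closed S_convex _ xmp_bnd xq (along _ _ _ pxs)).
  (* It remains to show that [q] lies in both sets defining [S]. *)
  split.
    apply: (Sol_weak_limit FP C_convex f_diag f_monotone f_convex f_subdiff
      f_hemi u_C Cq uq fe) => z _; exact: along.
  split=> //.
  apply: (hybrid_demiclosed FP T_hybrid abc_ge0 ab_gt0 d_ge0 u_C Cq
    (fun k => norm_bnd _ (u_bnd k)) uq); exact: along.
(* The limit [xs] is the same for all ultrafilters, so convergence holds along the sequence
   itself. *)
have xweak y : inner (x k) y @[k --> \oo] --> inner xs y.
  by apply: cvg_ultra => F FU ooF; exact: weak.
have uweak y : inner (u k) y @[k --> \oo] --> inner xs y.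
  have h : inner (x k) y - inner y (x k - u k) @[k --> \oo] --> inner xs y - 0.
    apply: cvgB => //; apply: (@cvg_inner0 _ _ _ _ _ (cst y) _ `|y|) => //.
    exact: nearW.
  rewrite subr0 in h; apply: cvg_trans h; apply: near_eq_cvg; apply: nearW => k.
  by rewrite (innerC y) innerDl innerNl opprB addrC subrK.
(* Riesz reduces convergence against the dual to convergence of inner products. *)
have dual (phi : {linear H -> R^o}) : continuous phi ->
    exists w, forall y, phi y = inner y w.
  move=> /linear_bounded_continuous/linear_boundedP phib.
  have [M phiM] := @filter_ex _ _ proper_pinfty_nbhs _ phib.
  by have [w wP] := riesz phiM; exists w => y; rewrite wP innerC.
exists xs; split=> // phi /dual[w wP].
  by rewrite wP; under eq_fun do rewrite wP; exact: xweak.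
by rewrite wP; under eq_fun do rewrite wP; exact: uweak.
Qed.
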